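(* Let $(\mathfrak g,[\cdot,\cdot],\alpha,d)$ be an object of $\mathbf{HomLieDer}_\alpha$, and let $\mathcal U_{\mathrm m}(\mathfrak g)=\mathcal F_{\mathrm m}(\mathfrak g)/I$ with the maps $\mu_U,\alpha_U,D_U$ induced by $\mu_{\mathrm m},\alpha_{\mathrm m},\widehat d$ on $\mathcal F_{\mathrm m}(\mathfrak g)$ respectively. Then the quadruple $(\mathcal U_{\mathrm m}(\mathfrak g),\mu_U,\alpha_U,D_U)$ is an object of $\mathbf{HomAsDer}_\alpha$.
   Context: All vector spaces are over a fixed field $\mathbb{K}$ of characteristic $0$. An object $(\mathfrak g,[\cdot,\cdot],\alpha,d)$ of $\mathbf{HomLieDer}_\alpha$ is a Hom-Lie algebra with an $\alpha$-derivation: $[\cdot,\cdot]$ is a skew-symmetric bilinear map on the vector space $\mathfrak g$, $\alpha,d:\mathfrak g\to\mathfrak g$ are linear, $[\alpha(x),[y,z]]+[\alpha(y),[z,x]]+[\alpha(z),[x,y]]=0$, $\alpha([x,y])=[\alpha(x),\alpha(y)]$, $d\circ\alpha=\alpha\circ d$ and $d([x,y])=[d(x),\alpha(y)]+[\alpha(x),d(y)]$ for all $x,y,z\in\mathfrak g$. A Hom-nonassociative algebra is a triple $(A,\mu,\alpha)$ with $\mu:A\times A\to A$ bilinear (written $ab$), $\alpha:A\to A$ linear and $\alpha(ab)=\alpha(a)\alpha(b)$ (no unit); it is Hom-associative if $\alpha(a)(bc)=(ab)\alpha(c)$ for all $a,b,c$. An $\alpha$-derivation is a linear $D:A\to A$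 with $D\alpha=\alpha D$ and $D(ab)=D(a)\alpha(b)+\alpha(a)D(b)$. Objects of $\mathbf{HomAsDer}_\alpha$ are Hom-associative algebras with an $\alpha$-derivation $(A,\mu,\alpha,D)$ (the twisting map varies with the object). Construction of $\mathcal F_{\mathrm m}(V)$ for a Hom-module $(V,\alpha_V)$ (vector space with linear endomorphism). For $n\ge1$ a weighted $n$-tree is a planar binary tree with $n$ leaves and a nonnegative integer attached to each internal vertex (the one-leaf tree has no internal vertex); $T_n^{\mathrm{wt}}$ is the set of these. For $\tau\in T_p^{\mathrm{wt}},\sigma\in T_q^{\mathrm{wt}}$, $\tau\vee\sigma\in T_{p+q}^{\mathrm{wt}}$ joins the two roots to a new lowest internal vertex of weight $0$ ($\tau$ left, $\sigma$ right); for $n\ge2$, $\tau[1]$ adds $1$ to the weight of the lowest internal vertex of $\tau\in T_n^{\mathrm{wt}}$. Let $F_{\mathrm{HNAs}}(V)=\bigoplus_{n\ge1}\bigoplus_{\tau\in T_n^{\mathrm{wt}}}V^{\otimes n}_\tau$ with $V^{\otimes n}_\tau$ a copy of $V^{\otimes n}$, and product $\mu_F((x_1\otimes\cdots\otimes x_n)_\tau,(x_{n+1}\otimes\cdots\otimes x_{n+m})_\sigma)=(x_1\otimes\cdots\otimes x_{n+m})_{\tau\vee\sigma}$; let $\alpha_F$ be the linear map with $\alpha_F|_V=\alpha_V$ and $\alpha_F((x_1\otimes\cdots\otimes x_n)_\tau)=(x_1\otimes\cdots\otimes x_n)_{\tau[1]}$ for $n\ge2$. Let $M_1$ be the two-sided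 ideal generated by all $\alpha_F(uv)-\alpha_F(u)\alpha_F(v)$, $M_{n+1}$ the two-sided ideal generated by $M_n\cup\alpha_F(M_n)$, $M_\infty=\bigcup_{n\ge1}M_n$. Then $\mathcal F_{\mathrm m}(V)=F_{\mathrm{HNAs}}(V)/M_\infty$ with induced product $\mu_{\mathrm m}$ and twisting map $\alpha_{\mathrm m}$; $j:V\to\mathcal F_{\mathrm m}(V)$ is the inclusion of $V$ (the $n=1$ summand) followed by the quotient map. It is the free Hom-nonassociative algebra on $(V,\alpha_V)$. Construction of $\mathcal U_{\mathrm m}(\mathfrak g)$. Apply this to $(V,\alpha_V)=(\mathfrak g,\alpha)$. $\widehat d:\mathcal F_{\mathrm m}(\mathfrak g)\to\mathcal F_{\mathrm m}(\mathfrak g)$ is the unique linear map with $\widehat dj=jd$, $\widehat d\alpha_{\mathrm m}=\alpha_{\mathrm m}\widehat d$, $\widehat d(xy)=\widehat d(x)\alpha_{\mathrm m}(y)+\alpha_{\mathrm m}(x)\widehat d(y)$. $I$ is the two-sided ideal of $\mathcal F_{\mathrm m}(\mathfrak g)$ generated by all $\alpha_{\mathrm m}(u)(vw)-(uv)\alpha_{\mathrm m}(w)$ ($u,v,w\in\mathcal F_{\mathrm m}(\mathfrak g)$) and all $j([x,y])-(j(x)j(y)-j(y)j(x))$ ($x,y\in\mathfrak g$). It satisfies $\alpha_{\mathrm m}(I)\subseteq I$, $\widehat d(I)\subseteq I$. With $\pi_I:\mathcal F_{\mathrm m}(\mathfrak g)\to\mathcal U_{\mathrm m}(\mathfrak g):=\mathcal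 F_{\mathrm m}(\mathfrak g)/I$ the quotient map, $\mu_U(\pi_I(u),\pi_I(v))=\pi_I(uv)$, $\alpha_U(\pi_I(u))=\pi_I(\alpha_{\mathrm m}(u))$, $D_U(\pi_I(u))=\pi_I(\widehat d(u))$. *)

(* Defs.v *)
From HB Require Import structures.
From mathcomp Require Import all_boot all_algebra sesquilinear.
From mathcomp Require Import generic_quotient ring_quotient finmap.
From mathcomp Require Import boolp classical_sets functions cardinality fsbigop.
Set Implicit Arguments.
Unset Strict Implicit.
Unset Printing Implicit Defensive.
Import GRing.Theory.
Local Open Scope ring_scope.
Local Open Scope quotient_scope.

Section LinPred.
Variables (K : fieldType) (V : lmodType K) (P : V -> Prop).
Hypotheses (P0 : P 0) (PD : forall a x y, P x -> P y -> P (a *: x + y)).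

Let B : {pred V} := fun x => `[< P x >].
Fact lin_pred_submod : subsemimod_closed B.
Proof.
split; first split; first exact/asboolP.
- move=> x y /asboolP Px /asboolP Py; apply/asboolP.
  by rewrite -[x]scale1r; apply: PD.
- move=> a x /asboolP Px; apply/asboolP.
  by rewrite -[_ *: _]addr0; apply: PD.
Qed.
Definition lin_pred : submodClosed V :=
  HB.pack B (GRing.isSubmodClosed.Build K V B lin_pred_submod).
End LinPred.

Section Span.
Variables (K : fieldType) (V : lmodType K) (X : V -> Prop).

Definition lin_span : {pred V} := fun v =>
  `[< forall S : submodClosed V, (forall x, X x -> x \in S) -> v \in S >].

Fact lin_span_submod : subsemimod_closed lin_span.
Proof.
split; first split.
- by apply/asboolP => S _; exact: rpred0.
- move=> x y /asboolP hx /asboolP hy; apply/asboolP => S XS.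
  by apply: rpredD; [exact: hx|exact: hy].
- move=> a x /asboolP hx; apply/asboolP => S XS.
  by apply: rpredZ; exact: hx.
Qed.
HB.instance Definition _ :=
  GRing.isSubmodClosed.Build K V lin_span lin_span_submod.

Lemma sub_lin_span x : X x -> x \in lin_span.
Proof. by move=> Xx; apply/asboolP => S; apply. Qed.

Lemma lin_span_ind (P : V -> Prop) :
  P 0 -> (forall a x y, P x -> P y -> P (a *: x + y)) ->
  (forall x, X x -> P x) -> forall x, x \in lin_span -> P x.
Proof.
move=> P0 PD PX x /asboolP /(_ (lin_pred P0 PD)) h.
by apply/asboolP/h => y /PX Py; exact/asboolP.
Qed.
End Span.

Section QuotMod.
Variables (K : fieldType) (V : lmodType K) (S : submodClosed V).

(* [submodClosed] does not provide closure under opposites, which the quotient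
   of the underlying additive group requires. *)
Definition submod_pred : {pred V} := S.
Fact submod_pred_zmod : zmod_closed submod_pred.
Proof.
split=> [|x y Sx Sy]; first exact: (@rpred0 _ S).
by rewrite -scaleN1r; apply: (@rpredD _ S) => //; exact: (@rpredZ _ _ S).
Qed.
HB.instance Definition _ := GRing.isZmodClosed.Build V submod_pred submod_pred_zmod.

Definition quotmod := {ideal_quot submod_pred}.
HB.instance Definition _ := GRing.Zmodule.on quotmod.

Definition qproj (x : V) : quotmod := \pi_({ideal_quot submod_pred}) x.
Definition qrepr (x : quotmod) : V := repr x.

Lemma qreprK : cancel qrepr qproj.
Proof. exact: reprK. Qed.

Lemma qproj_eq x y : (qproj x = qproj y) <-> (x - y \in S).
Proof.
have E : (x - y \in S) = (qproj x == qproj y) :=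
  Quotient.idealrBE submod_pred x y.
by rewrite E; split=> /eqP.
Qed.

Lemma qrepr_sub x : qrepr (qproj x) - x \in S.
Proof. by apply/qproj_eq; rewrite qreprK. Qed.

Fact qproj_zmod_morphism : zmod_morphism qproj.
Proof. by move=> x y; rewrite /qproj raddfB. Qed.
HB.instance Definition _ :=
  GRing.isZmodMorphism.Build V quotmod qproj qproj_zmod_morphism.

Definition qscale (a : K) (x : quotmod) : quotmod := qproj (a *: qrepr x).

Lemma qscale_proj a x : qscale a (qproj x) = qproj (a *: x).
Proof. by apply/qproj_eq; rewrite -scalerBr rpredZ// qrepr_sub. Qed.

Fact qscaleA a b v : qscale a (qscale b v) = qscale (a * b) v.
Proof. by rewrite -(qreprK v) !qscale_proj scalerA. Qed.
Fact qscale1 : left_id 1 qscale.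
Proof. by move=> v; rewrite -(qreprK v) qscale_proj scale1r. Qed.
Fact qscaleDr : right_distributive qscale +%R.
Proof.
by move=> a u v; rewrite -(qreprK u) -(qreprK v) -raddfD !qscale_proj scalerDr raddfD.
Qed.
Fact qscaleDl v : {morph qscale^~ v : a b / a + b}.
Proof. by move=> a b; rewrite -(qreprK v) !qscale_proj scalerDl raddfD. Qed.
HB.instance Definition _ := GRing.Zmodule_isLmodule.Build K quotmod
  qscaleA qscale1 qscaleDr qscaleDl.

Fact qproj_scalable : scalable qproj.
Proof. by move=> a x; rewrite -qscale_proj. Qed.
HB.instance Definition _ :=
  GRing.isScalable.Build K V quotmod *:%R qproj qproj_scalable.

Lemma qproj_eq0 x : (qproj x = 0) <-> (x \in S).
Proof. by rewrite -(raddf0 qproj) qproj_eq subr0. Qed.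

End QuotMod.
Arguments qproj {K V} S x.

Section LinearProp.
Variables (K : fieldType) (V W : lmodType K) (f : V -> W) (f_lin : linear f).

Definition bundle_linear : {linear V -> W} :=
  HB.pack f (GRing.isLinear.Build K V W *:%R f f_lin).

Lemma lin0 : f 0 = 0. Proof. exact: (raddf0 bundle_linear). Qed.
Lemma linB x y : f (x - y) = f x - f y. Proof. exact: (raddfB bundle_linear). Qed.
Lemma linD x y : f (x + y) = f x + f y. Proof. exact: (raddfD bundle_linear). Qed.
Lemma linZ a x : f (a *: x) = a *: f x. Proof. exact: (linearZZ bundle_linear). Qed.
End LinearProp.

Section QuotLift.
Variables (K : fieldType) (V W : lmodType K) (S : submodClosed V) (f : V -> W).

(* The induced map, computed on a representative; quot_liftE shows that it does
   not depend on the representative when f is linear and vanishes on S. *)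
Definition quot_lift (x : quotmod S) : W := f (qrepr x).

Hypotheses (f_lin : linear f) (f0 : forall x, x \in S -> f x = 0).

Lemma quot_liftE x : quot_lift (qproj S x) = f x.
Proof. by apply/subr0_eq; rewrite /quot_lift -linB// f0 ?qrepr_sub. Qed.

Lemma quot_lift_linear : linear quot_lift.
Proof.
by move=> a u v; rewrite -(qreprK u) -(qreprK v) -linearP !quot_liftE f_lin.
Qed.
End QuotLift.

Section DSum.
Variables (K : fieldType) (I : choiceType) (V : I -> lmodType K).

(* The external direct sum: families that vanish at all but finitely many i. *)
Record dsum := DSum {
  dsum_fun :> forall i, V i;
  dsum_finite : finite_set [set i | dsum_fun i != 0] }.

HB.instance Definition _ := gen_eqMixin dsum.
HB.instance Definition _ := gen_choiceMixin dsum.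

Lemma dsumP (x y : dsum) : (forall i, x i = y i) -> x = y.
Proof.
case: x y => [f hf] [g hg] /= fg.
have e : f = g by apply: functional_extensionality_dep.
by rewrite -e in hg *; congr DSum; exact: Prop_irrelevance.
Qed.

Fact dsum0_finite : finite_set [set i | (0 : V i) != 0].
Proof. by apply: (sub_finite_set _ (finite_set0 I)) => i /=; rewrite eqxx. Qed.
Definition dsum0 := DSum dsum0_finite.

Fact dsumP_finite a (x y : dsum) : finite_set [set i | a *: x i + y i != 0].
Proof.
have: finite_set ([set i | x i != 0] `|` [set i | y i != 0])%classic.
  by rewrite finite_setU; split; exact: dsum_finite.
apply: sub_finite_set => i /=.
by case: (eqVneq (x i) 0) => [->|]; [rewrite scaler0 add0r; right|left].
Qed.
Definition dsum_comb a x y := DSum (dsumP_finite a x y).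
Definition dsum_add x y := dsum_comb 1 x y.
Definition dsum_opp x := dsum_comb (-1) x dsum0.
Definition dsum_scale a x := dsum_comb a x dsum0.

Fact dsum_addA : associative dsum_add.
Proof. by move=> x y z; apply: dsumP => i /=; rewrite !scale1r addrA. Qed.
Fact dsum_addC : commutative dsum_add.
Proof. by move=> x y; apply: dsumP => i /=; rewrite !scale1r addrC. Qed.
Fact dsum_add0 : left_id dsum0 dsum_add.
Proof. by move=> x; apply: dsumP => i /=; rewrite !scale1r add0r. Qed.
Fact dsum_addN : left_inverse dsum0 dsum_opp dsum_add.
Proof.
by move=> x; apply: dsumP => i /=; rewrite scale1r addr0 scaleN1r addNr.
Qed.
HB.instance Definition _ :=
  GRing.isZmodule.Build dsum dsum_addA dsum_addC dsum_add0 dsum_addN.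

Lemma dsum0E i : (0 : dsum) i = 0. Proof. by []. Qed.
Lemma dsumDE (x y : dsum) i : (x + y) i = x i + y i.
Proof. by rewrite [x + y]/(dsum_add x y) /= scale1r. Qed.

Fact dsum_scaleA a b v : dsum_scale a (dsum_scale b v) = dsum_scale (a * b) v.
Proof. by apply: dsumP => i /=; rewrite !addr0 scalerA. Qed.
Fact dsum_scale1 : left_id 1 dsum_scale.
Proof. by move=> v; apply: dsumP => i /=; rewrite !addr0 scale1r. Qed.
Fact dsum_scaleDr : right_distributive dsum_scale +%R.
Proof. by move=> a u v; apply: dsumP => i /=; rewrite !addr0 !scale1r scalerDr. Qed.
Fact dsum_scaleDl v : {morph dsum_scale^~ v : a b / a + b}.
Proof. by move=> a b; apply: dsumP => i /=; rewrite !addr0 scale1r scalerDl. Qed.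
HB.instance Definition _ := GRing.Zmodule_isLmodule.Build K dsum
  dsum_scaleA dsum_scale1 dsum_scaleDr dsum_scaleDl.

Lemma dsumZE a (x : dsum) i : (a *: x) i = a *: x i.
Proof. by rewrite [a *: x]/(dsum_scale a x) /= addr0. Qed.

Section Inj.
Variable i : I.

Definition dsum_inj_fun (v : V i) (j : I) : V j :=
  if i =P j is ReflectT e then ecast k (V k) e v else 0.

Lemma dsum_inj_funE v : dsum_inj_fun v i = v.
Proof.
by rewrite /dsum_inj_fun; case: eqP => // e; rewrite (eq_axiomK e).
Qed.

Lemma dsum_inj_fun0 v j : i != j -> dsum_inj_fun v j = 0.
Proof. by rewrite /dsum_inj_fun; case: eqP. Qed.

Fact dsum_inj_finite v : finite_set [set j | dsum_inj_fun v j != 0].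
Proof.
apply: (sub_finite_set _ (finite_set1 i)) => j /= /eqP h.
by apply/eqP; apply: contra_notT h => ij; rewrite dsum_inj_fun0// eq_sym.
Qed.
Definition dsum_inj v : dsum := DSum (dsum_inj_finite v).

Fact dsum_inj_linear : linear dsum_inj.
Proof.
move=> a u v; apply: dsumP => j; rewrite dsumDE dsumZE /=.
case: (eqVneq i j) => [<-|ij]; first by rewrite !dsum_inj_funE.
by rewrite !dsum_inj_fun0// scaler0 addr0.
Qed.
HB.instance Definition _ :=
  GRing.isLinear.Build K (V i) dsum *:%R dsum_inj dsum_inj_linear.
End Inj.

Section Lift.
Variables (W : lmodType K) (f : forall i, V i -> W).

(* The map out of the direct sum given by f i on the i-th summand; linear as
   soon as every f i is (dsum_lift_linear). *)
Definition dsum_lift (x : dsum) : W := \sum_(i \in [set: I]) f (x i).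

Definition dsum_supp (x : dsum) : {fset I} := fset_set [set i | x i != 0].

Lemma dsum_suppP (x : dsum) i : i \notin dsum_supp x -> x i = 0.
Proof.
rewrite /dsum_supp in_fset_set; last exact: dsum_finite.
by rewrite notin_setE /= => /negP; rewrite negbK => /eqP.
Qed.

Hypothesis f_lin : forall i, linear (@f i).

Lemma dsum_liftE (A : {fset I}) (x : dsum) :
  (forall i, i \notin A -> x i = 0) -> dsum_lift x = \sum_(i <- A) f (x i).
Proof. by move=> h; apply: fsbigTE => i /h ->; rewrite lin0. Qed.

Lemma dsum_lift_linear : linear dsum_lift.
Proof.
move=> a x y; pose A := (dsum_supp x `|` dsum_supp y)%fset.
have hx i : i \notin A -> x i = 0.
  by rewrite in_fsetU negb_or => /andP[/dsum_suppP].
have hy i : i \notin A -> y i = 0.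
  by rewrite in_fsetU negb_or => /andP[_ /dsum_suppP].
have hxy i : i \notin A -> (a *: x + y) i = 0.
  by move=> iA; rewrite dsumDE dsumZE hx// hy// scaler0 addr0.
rewrite (dsum_liftE hx) (dsum_liftE hy) (dsum_liftE hxy) scaler_sumr -big_split.
by apply: eq_bigr => i _; rewrite dsumDE dsumZE f_lin.
Qed.

Lemma dsum_lift_inj i v : dsum_lift (dsum_inj (i:=i) v) = f v.
Proof.
rewrite (@dsum_liftE [fset i]%fset) ?big_seq_fset1 /= ?dsum_inj_funE//.
by move=> j; rewrite inE eq_sym => /dsum_inj_fun0.
Qed.
End Lift.

Lemma dsum_ind_lin (P : dsum -> Prop) :
  (forall i (v : V i), P (dsum_inj v)) -> P 0 ->
  (forall x y, P x -> P y -> P (x + y)) -> forall x, P x.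
Proof.
move=> Pi P0 PD x.
suff -> : x = \sum_(i <- dsum_supp x) dsum_inj (x i) by apply: big_ind.
apply: dsumP => j.
have E (s : seq I) (F : I -> dsum) : (\sum_(i <- s) F i) j = \sum_(i <- s) F i j.
  exact: (big_morph (fun x : dsum => x j) (fun x y => dsumDE x y j) (dsum0E j)).
rewrite E; case: (boolP (j \in dsum_supp x)) => jx.
  rewrite (big_fsetD1 j)//= dsum_inj_funE big1_fset ?addr0// => i.
  by rewrite !inE => /andP[ij _] _; rewrite dsum_inj_fun0.
rewrite (dsum_suppP jx) big1_seq// => i /andP[_ ix] /=.
by rewrite dsum_inj_fun0//; apply: contraNneq jx => <-.
Qed.

End DSum.
Arguments dsum_inj {K I} V i v.

Section FreeMod.
Variables (K : fieldType) (X : choiceType).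

Definition regmod (x : X) : lmodType K := K^o.
Definition freemod := dsum regmod.
HB.instance Definition _ := GRing.Lmodule.on freemod.

Definition delta (x : X) : freemod := dsum_inj regmod x (1 : K).

Section Lift.
Variables (W : lmodType K) (f : X -> W).

Definition free_lift (u : freemod) : W :=
  dsum_lift (fun x (c : regmod x) => (c : K) *: f x) u.

Lemma free_lift_linear : linear free_lift.
Proof.
by apply: dsum_lift_linear => x a u v; rewrite scalerDl scalerA.
Qed.

Lemma free_liftE x : free_lift (delta x) = f x.
Proof.
rewrite /free_lift dsum_lift_inj ?scale1r// => y a u v.
by rewrite scalerDl scalerA.
Qed.
End Lift.

Lemma free_ind (P : freemod -> Prop) :
  (forall x, P (delta x)) -> P 0 ->
  (forall a x y, P x -> P y -> P (a *: x + y)) -> forall x, P x.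
Proof.
move=> Pd P0 PD; apply: dsum_ind_lin => // [x c|x y Px Py].
  have -> : dsum_inj regmod x c = (c : K) *: delta x + 0.
    by rewrite addr0 /delta -linearZ; congr dsum_inj; exact/esym/mulr1.
  exact: PD.
by rewrite -[x]scale1r; apply: PD.
Qed.
End FreeMod.
Arguments delta {K X} x.

Section Tensor.
Variables (K : fieldType) (V : lmodType K) (n : nat).

(* An n-tuple of vectors of V is a row vector of type 'rV[V]_n, so that row_mx
   is concatenation. x, y, z agree away from position i and there
   x_i = a y_i + z_i. *)
Definition multilin_rel (i : 'I_n) (a : K) (x y z : 'rV[V]_n) : Prop :=
  x 0 i = a *: y 0 i + z 0 i /\
  forall j, j != i -> x 0 j = y 0 j /\ x 0 j = z 0 j.

Definition multilinear (W : lmodType K) (f : 'rV[V]_n -> W) : Prop :=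
  forall i a x y z, multilin_rel i a x y z -> f x = a *: f y + f z.

Definition tensor_rel (u : freemod K 'rV[V]_n) : Prop :=
  exists i a x y z,
    multilin_rel i a x y z /\ u = delta x - (a *: delta y + delta z).

(* V tensored n times: the free module on n-tuples modulo multilinearity. *)
Definition tensor_power := quotmod (lin_span tensor_rel).
HB.instance Definition _ := GRing.Lmodule.on tensor_power.

Definition pure_tensor (x : 'rV[V]_n) : tensor_power := qproj _ (delta x).

Lemma pure_multilinear : multilinear pure_tensor.
Proof.
move=> i a x y z h; rewrite /pure_tensor -linearP; apply/qproj_eq/sub_lin_span.
by exists i, a, x, y, z.
Qed.

Section Lift.
Variables (W : lmodType K) (f : 'rV[V]_n -> W).

Definition tensor_lift (u : tensor_power) : W := quot_lift (free_lift f) u.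

Hypothesis f_lin : multilinear f.

Fact tensor_lift_subproof u : u \in lin_span tensor_rel -> free_lift f u = 0.
Proof.
have L := @free_lift_linear K _ W f.
move: u; apply: lin_span_ind => [|a x y ex ey|_ [i [a [x [y [z [h ->]]]]]]].
- exact: lin0.
- by rewrite L ex ey scaler0 addr0.
- by rewrite (linB L) L !free_liftE (f_lin h) subrr.
Qed.

Lemma tensor_lift_linear : linear tensor_lift.
Proof.
by apply: quot_lift_linear; [exact: free_lift_linear|exact: tensor_lift_subproof].
Qed.

Lemma tensor_lift_pure x : tensor_lift (pure_tensor x) = f x.
Proof.
rewrite /tensor_lift quot_liftE ?free_liftE//; first exact: free_lift_linear.
exact: tensor_lift_subproof.
Qed.
End Lift.

Lemma tensor_ind (P : tensor_power -> Prop) :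
  (forall x, P (pure_tensor x)) -> P 0 ->
  (forall a x y, P x -> P y -> P (a *: x + y)) -> forall x, P x.
Proof.
move=> Pp P0 PD x; rewrite -(qreprK x).
elim/free_ind: (qrepr x) => [y||a u v Pu Pv]; first exact: Pp.
  by rewrite raddf0.
by rewrite linearP; apply: PD.
Qed.
End Tensor.
Arguments pure_tensor {K V n} x.

(* All weighted trees at once; T_n^wt is the set of t with leaves t = n. *)
Inductive wtree := Leaf | Node of nat & wtree & wtree.

HB.instance Definition _ := gen_eqMixin wtree.
HB.instance Definition _ := gen_choiceMixin wtree.

Fixpoint leaves (t : wtree) : nat :=
  if t is Node _ l r then leaves l + leaves r else 1.

Definition vee (t s : wtree) : wtree := Node 0 t s.

(* tau[1]; only used on trees with at least two leaves. *)
Definition tree_shift (t : wtree) : wtree :=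
  if t is Node k l r then Node k.+1 l r else Leaf.

Section FreeHomNonassoc.
Variables (K : fieldType) (V : lmodType K).

Definition tree_summand (t : wtree) : lmodType K := tensor_power V (leaves t).

(* The sum over n >= 1 and tau in T_n^wt is a single sum over wtree. *)
Definition FHNAs := dsum tree_summand.
HB.instance Definition _ := GRing.Lmodule.on FHNAs.

Definition tree_pure (t : wtree) (x : 'rV[V]_(leaves t)) : FHNAs :=
  dsum_inj tree_summand t (pure_tensor x).

(* The inclusion of V as the summand of the one-leaf tree. *)
Definition vec (v : V) : FHNAs := tree_pure (t := Leaf) (const_mx v).

(* The linear map with value f t x on tree_pure t x (see tree_liftE), for f t
   multilinear. *)
Definition tree_lift (W : lmodType K)
    (f : forall t, 'rV[V]_(leaves t) -> W) (u : FHNAs) : W :=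
  dsum_lift (fun t (w : tree_summand t) => tensor_lift (@f t) w) u.

Lemma tree_lift_linear W f :
  (forall t, multilinear (f t)) -> linear (@tree_lift W f).
Proof. by move=> h; apply: dsum_lift_linear => t; apply: tensor_lift_linear. Qed.

Lemma tree_liftE W f t x :
  (forall t, multilinear (f t)) -> @tree_lift W f (tree_pure x) = f t x.
Proof.
move=> h; rewrite /tree_lift dsum_lift_inj ?tensor_lift_pure// => s.
exact: tensor_lift_linear.
Qed.

Lemma tree_pure_multilinear t : multilinear (@tree_pure t).
Proof.
by move=> i a x y z /pure_multilinear e; rewrite /tree_pure e linearP.
Qed.

Lemma FHNAs_ind (P : FHNAs -> Prop) :
  (forall t x, P (@tree_pure t x)) -> P 0 ->
  (forall a x y, P x -> P y -> P (a *: x + y)) -> forall x, P x.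
Proof.
move=> Pp P0 PD; apply: dsum_ind_lin => // [t w|x y Px Py].
  elim/tensor_ind: w => [x||a x y Px Py]; first exact: Pp.
    by rewrite raddf0.
  by rewrite linearP; apply: PD.
by rewrite -[x]scale1r; apply: PD.
Qed.

Definition muF (u v : FHNAs) : FHNAs :=
  tree_lift (fun t (x : 'rV_(leaves t)) =>
    tree_lift (fun s (y : 'rV_(leaves s)) =>
      tree_pure (t := vee t s) (row_mx x y)) v) u.

Lemma multilin_rel_rowl m n i a (x y z : 'rV[V]_m) (w : 'rV[V]_n) :
  multilin_rel i a x y z ->
  multilin_rel (lshift n i) a (row_mx x w) (row_mx y w) (row_mx z w).
Proof.
case=> e h; split=> [|j]; first by rewrite !row_mxEl.
rewrite -[j]splitK; case: (fintype.split j) => k /= ne; last by rewrite !row_mxEr.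
by rewrite !row_mxEl; apply: h; apply: contraNneq ne => ->.
Qed.

Lemma multilin_rel_rowr m n i a (x y z : 'rV[V]_n) (w : 'rV[V]_m) :
  multilin_rel i a x y z ->
  multilin_rel (rshift m i) a (row_mx w x) (row_mx w y) (row_mx w z).
Proof.
case=> e h; split=> [|j]; first by rewrite !row_mxEr.
rewrite -[j]splitK; case: (fintype.split j) => k /= ne; first by rewrite !row_mxEl.
by rewrite !row_mxEr; apply: h; apply: contraNneq ne => ->.
Qed.

Let muFr_multilinear t (x : 'rV_(leaves t)) s :
  multilinear (fun y : 'rV_(leaves s) => tree_pure (t := vee t s) (row_mx x y)).
Proof.
move=> i a y z w /(multilin_rel_rowr x).
exact: (@tree_pure_multilinear (vee t s)).
Qed.

Let muFl_multilinear v t :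
  multilinear (fun x : 'rV_(leaves t) =>
    tree_lift (fun s (y : 'rV_(leaves s)) =>
      tree_pure (t := vee t s) (row_mx x y)) v).
Proof.
move=> i a x y z h; pose g u := tree_lift (fun s (y : 'rV_(leaves s)) =>
      tree_pure (t := vee t s) (row_mx u y)).
have gl u : linear (g u) by apply: tree_lift_linear; exact: muFr_multilinear.
rewrite -/(g x v) -/(g y v) -/(g z v); elim/FHNAs_ind: v => [s w||b v w ev ew].
- have E u : g u (tree_pure w) = tree_pure (t := vee t s) (row_mx u w).
    exact: (tree_liftE w (muFr_multilinear u)).
  rewrite !E.
  by move/(multilin_rel_rowl w): h; exact: (@tree_pure_multilinear (vee t s)).
- by rewrite !(lin0 (gl _)) scaler0 addr0.
- by rewrite !gl ev ew !scalerDr addrACA !scalerA mulrC.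
Qed.

Lemma muF_linearl v : linear (muF^~ v).
Proof. by apply: tree_lift_linear => t; exact: muFl_multilinear. Qed.

Lemma muF_pure t s (x : 'rV_(leaves t)) (y : 'rV_(leaves s)) :
  muF (tree_pure x) (tree_pure y) = tree_pure (t := vee t s) (row_mx x y).
Proof.
rewrite /muF (tree_liftE x (muFl_multilinear _)).
exact: (tree_liftE y (muFr_multilinear x)).
Qed.

Lemma muF_linearr u : linear (muF u).
Proof.
move=> a v w; elim/FHNAs_ind: u => [t x||b u u' eu eu'].
- rewrite /muF !(tree_liftE x (muFl_multilinear _)).
  exact: (tree_lift_linear (muFr_multilinear x)).
- by rewrite !(lin0 (muF_linearl _)) scaler0 addr0.
- by rewrite !muF_linearl eu eu' !scalerDr addrACA !scalerA mulrC.
Qed.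

Section Maps.
Variables alpha d : {linear V -> V}.

Definition alphaF : FHNAs -> FHNAs :=
  tree_lift (fun t => match t return 'rV[V]_(leaves t) -> FHNAs with
    | Leaf => fun x => tree_pure (t := Leaf) (map_mx alpha x)
    | Node k l r => fun x => tree_pure (t := tree_shift (Node k l r)) x
    end).

Lemma multilin_rel_map n (f : {linear V -> V}) i a (x y z : 'rV[V]_n) :
  multilin_rel i a x y z ->
  multilin_rel i a (map_mx f x) (map_mx f y) (map_mx f z).
Proof.
case=> e h; split=> [|j /h[e1 e2]]; rewrite !mxE; first by rewrite e linearP.
by rewrite -e1 -e2.
Qed.

Let alphaF_multilinear t :
  multilinear (match t return 'rV[V]_(leaves t) -> FHNAs with
    | Leaf => fun x => tree_pure (t := Leaf) (map_mx alpha x)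
    | Node k l r => fun x => tree_pure (t := tree_shift (Node k l r)) x
    end).
Proof.
case: t => [|k l r] i a x y z.
  by move/(multilin_rel_map alpha); exact: (@tree_pure_multilinear Leaf).
exact: (@tree_pure_multilinear (tree_shift (Node k l r))).
Qed.

Lemma alphaF_linear : linear alphaF.
Proof. exact: tree_lift_linear. Qed.

Lemma alphaF_leaf (x : 'rV_(leaves Leaf)) :
  alphaF (tree_pure x) = tree_pure (t := Leaf) (map_mx alpha x).
Proof. exact: (tree_liftE x alphaF_multilinear). Qed.

Lemma alphaF_node k l r (x : 'rV_(leaves (Node k l r))) :
  alphaF (tree_pure x) = tree_pure (t := tree_shift (Node k l r)) x.
Proof. exact: (tree_liftE x alphaF_multilinear). Qed.

Lemma alphaF_vec v : alphaF (vec v) = vec (alpha v).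
Proof. by rewrite alphaF_leaf map_const_mx. Qed.

(* The lift of d to the free module before multiplicativity is imposed: on a
   tree (l \/ r)[k] the Leibniz rule and commutation with alphaF force
   alphaF^k (d(l) alphaF(r) + alphaF(l) d(r)). *)
Fixpoint dF_pure (t : wtree) : 'rV[V]_(leaves t) -> FHNAs :=
  match t with
  | Leaf => fun x => tree_pure (t := Leaf) (map_mx d x)
  | Node k l r => fun x : 'rV_(leaves l + leaves r) =>
      iter k alphaF
        (muF (dF_pure (lsubmx x)) (alphaF (tree_pure (rsubmx x))) +
         muF (alphaF (tree_pure (lsubmx x))) (dF_pure (rsubmx x)))
  end.

Definition dF : FHNAs -> FHNAs := tree_lift dF_pure.

Lemma multilin_rel_split m n i a (x y z : 'rV[V]_(m + n)) :
  multilin_rel i a x y z ->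
  (exists j, multilin_rel j a (lsubmx x) (lsubmx y) (lsubmx z) /\
             rsubmx x = rsubmx y /\ rsubmx x = rsubmx z) \/
  (exists j, multilin_rel j a (rsubmx x) (rsubmx y) (rsubmx z) /\
             lsubmx x = lsubmx y /\ lsubmx x = lsubmx z).
Proof.
case; rewrite -[i]splitK; case: (fintype.split i) => j /= e h; [left|right]; exists j.
  have r k : x 0 (rshift m k) = y 0 (rshift m k) /\
             x 0 (rshift m k) = z 0 (rshift m k).
    by apply: h; rewrite eq_rlshift.
  split; last by split; apply/rowP => k; rewrite !mxE; case: (r k).
  split=> [|k kj]; rewrite !mxE ?e//.
  by apply: h; apply: contraNneq kj => /lshift_inj ->.
have l k : x 0 (lshift n k) = y 0 (lshift n k) /\
           x 0 (lshift n k) = z 0 (lshift n k).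
  by apply: h; rewrite eq_lrshift.
split; last by split; apply/rowP => k; rewrite !mxE; case: (l k).
split=> [|k kj]; rewrite !mxE ?e//.
by apply: h; apply: contraNneq kj => /rshift_inj ->.
Qed.

Lemma iter_alphaF_linear k : linear (iter k alphaF).
Proof. by elim: k => [//|k IH] a x y; rewrite !iterS IH alphaF_linear. Qed.

Lemma dF_pure_multilinear t : multilinear (@dF_pure t).
Proof.
elim: t => [|k l IHl r IHr] i a x y z.
  by move/(multilin_rel_map d); exact: (@tree_pure_multilinear Leaf).
move=> /= h; rewrite -iter_alphaF_linear; congr iter.
case: (multilin_rel_split h) => -[j [hj [e1 e2]]]; rewrite -e1 -e2.
  rewrite (IHl _ _ _ _ _ hj) (tree_pure_multilinear hj) alphaF_linear.
  by rewrite !muF_linearl scalerDr addrACA.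
rewrite (IHr _ _ _ _ _ hj) (tree_pure_multilinear hj) alphaF_linear.
by rewrite !muF_linearr scalerDr addrACA.
Qed.

Lemma dF_linear : linear dF.
Proof. exact: (tree_lift_linear dF_pure_multilinear). Qed.

Lemma dF_vec v : dF (vec v) = vec (d v).
Proof.
by rewrite /dF (tree_liftE _ dF_pure_multilinear) /= map_const_mx.
Qed.

Lemma dF_mul u v : dF (muF u v) = muF (dF u) (alphaF v) + muF (alphaF u) (dF v).
Proof.
elim/FHNAs_ind: u => [t x||a u u' eu eu'].
- elim/FHNAs_ind: v => [s y||a v v' ev ev'].
  + rewrite muF_pure /dF !(tree_liftE _ dF_pure_multilinear) /=.
    by rewrite row_mxKl row_mxKr.
  + by rewrite !(lin0 (muF_linearr _), lin0 dF_linear, lin0 alphaF_linear) addr0.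
  + rewrite !(muF_linearr, dF_linear, alphaF_linear) ev ev' scalerDr addrACA.
    by [].
- by rewrite !(lin0 (muF_linearl _), lin0 dF_linear, lin0 alphaF_linear) addr0.
- by rewrite !(muF_linearl, dF_linear, alphaF_linear) eu eu' scalerDr addrACA.
Qed.

Lemma dF_alpha : (forall v, d (alpha v) = alpha (d v)) ->
  forall u, dF (alphaF u) = alphaF (dF u).
Proof.
move=> da; elim/FHNAs_ind => [[|k l r] x||a u v eu ev].
- rewrite /dF alphaF_leaf !(tree_liftE _ dF_pure_multilinear) /= alphaF_leaf.
  by congr tree_pure; apply/rowP => i; rewrite !mxE.
- by rewrite /dF alphaF_node !(tree_liftE _ dF_pure_multilinear).
- by rewrite !(lin0 dF_linear, lin0 alphaF_linear).
- by rewrite !(dF_linear, alphaF_linear) eu ev.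
Qed.
End Maps.
End FreeHomNonassoc.

Section Ideal.
Variables (K : fieldType) (A : lmodType K) (mu : A -> A -> A).

Definition two_sided (S : {pred A}) : Prop :=
  forall a x, x \in S -> mu a x \in S /\ mu x a \in S.

Definition ideal_gen (X : A -> Prop) : {pred A} := fun v =>
  `[< forall S : submodClosed A,
        two_sided S -> (forall x, X x -> x \in S) -> v \in S >].

Fact ideal_gen_submod X : subsemimod_closed (ideal_gen X).
Proof.
split; first split.
- by apply/asboolP => S _ _; exact: rpred0.
- move=> x y /asboolP hx /asboolP hy; apply/asboolP => S SI XS.
  by apply: rpredD; [exact: hx|exact: hy].
- move=> a x /asboolP hx; apply/asboolP => S SI XS.
  by apply: rpredZ; exact: hx.
Qed.
HB.instance Definition _ X :=
  GRing.isSubmodClosed.Build K A (ideal_gen X) (ideal_gen_submod X).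

Lemma sub_ideal_gen (X : A -> Prop) x : X x -> x \in ideal_gen X.
Proof. by move=> Xx; apply/asboolP => S _; apply. Qed.

Lemma ideal_gen_two_sided X : two_sided (ideal_gen X).
Proof.
move=> a x /asboolP hx; split; apply/asboolP => S SI XS;
  by have [] := SI a _ (hx S SI XS).
Qed.

Lemma ideal_gen_ind (X P : A -> Prop) :
  P 0 -> (forall a x y, P x -> P y -> P (a *: x + y)) ->
  (forall a x, P x -> P (mu a x) /\ P (mu x a)) ->
  (forall x, X x -> P x) -> forall x, x \in ideal_gen X -> P x.
Proof.
move=> P0 PD PI PX x /asboolP /(_ (lin_pred P0 PD)) h.
apply/asboolP/h => [a y /asboolP /(PI a)[Pl Pr]|y /PX Py]; last exact/asboolP.
by split; exact/asboolP.
Qed.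
End Ideal.

Section Quotients.
Variables (K : fieldType) (A : lmodType K) (mu : A -> A -> A) (f : A -> A).
Variable S : submodClosed A.

(* Induced operations on A / S, computed on representatives; quot_mulE and
   quot_mapE give independence of the representatives. *)
Definition quot_mul (x y : quotmod S) : quotmod S :=
  qproj S (mu (qrepr x) (qrepr y)).

Definition quot_map (x : quotmod S) : quotmod S := qproj S (f (qrepr x)).

Lemma quot_mulE : (forall y, linear (mu^~ y)) -> (forall x, linear (mu x)) ->
  two_sided mu S -> forall x y, quot_mul (qproj S x) (qproj S y) = qproj S (mu x y).
Proof.
move=> mul mur SI x y; rewrite /quot_mul; apply/qproj_eq.
set x' := qrepr _; set y' := qrepr _.
have -> : mu x' y' - mu x y = mu (x' - x) y' + mu x (y' - y).
  by rewrite (linB (mul _)) (linB (mur _)) addrA subrK.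
by apply: rpredD; [have [] := SI y' _ (qrepr_sub S x)
                  |have [] := SI x _ (qrepr_sub S y)].
Qed.

Lemma quot_mapE : linear f -> (forall x, x \in S -> f x \in S) ->
  forall x, quot_map (qproj S x) = qproj S (f x).
Proof.
by move=> fl fS x; apply/qproj_eq; rewrite -(linB fl); apply/fS/qrepr_sub.
Qed.
End Quotients.
Arguments quot_mul {K A} mu S x y.
Arguments quot_map {K A} f S x.

Section Multiplicative.
Variables (K : fieldType) (A : lmodType K) (mu : A -> A -> A) (al : A -> A).

(* Indexed from 0: M_seq n is M_{n+1}. *)
Fixpoint M_seq (n : nat) : {pred A} :=
  if n is n'.+1 then
    ideal_gen mu (fun w => w \in M_seq n' \/ exists2 u, u \in M_seq n' & w = al u)
  else ideal_gen mu (fun w => exists u v, w = al (mu u v) - mu (al u) (al v)).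

Definition M_inf : {pred A} := fun w => `[< exists n, w \in M_seq n >].

Lemma M_seq_le m n x : (m <= n)%N -> x \in M_seq m -> x \in M_seq n.
Proof.
move=> /subnK <-; elim: (n - m)%N => [//|k IH] xm.
by apply: sub_ideal_gen; left; exact: IH.
Qed.

Lemma M_seq_comb n a x y : x \in M_seq n -> y \in M_seq n -> a *: x + y \in M_seq n.
Proof.
by case: n => [|n] hx hy; apply: rpredD => //; apply: rpredZ.
Qed.

Lemma M_seq_two_sided n : two_sided mu (M_seq n).
Proof. by case: n => [|n]; exact: ideal_gen_two_sided. Qed.

Lemma M_seq_al n x : x \in M_seq n -> al x \in M_seq n.+1.
Proof. by move=> xn; apply: sub_ideal_gen; right; exists x. Qed.

Lemma M_infP x : reflect (exists n, x \in M_seq n) (x \in M_inf).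
Proof. exact: asboolP. Qed.

Fact M_inf_submod : subsemimod_closed M_inf.
Proof.
have M0 : 0 \in M_inf by apply/M_infP; exists 0; exact: rpred0.
have MD a x y : x \in M_inf -> y \in M_inf -> a *: x + y \in M_inf.
  move=> /M_infP[m xm] /M_infP[n yn]; apply/M_infP; exists (maxn m n).
  apply: M_seq_comb; [apply: M_seq_le xm|apply: M_seq_le yn].
    exact: leq_maxl.
  exact: leq_maxr.
split; first split=> // x y xM yM; first by rewrite -[x]scale1r MD.
by move=> a x xM; rewrite -[_ *: _]addr0 MD.
Qed.
HB.instance Definition _ := GRing.isSubmodClosed.Build K A M_inf M_inf_submod.

Lemma M_inf_two_sided : two_sided mu M_inf.
Proof.
move=> a x /M_infP[n /(M_seq_two_sided a)[l r]].
by split; apply/M_infP; exists n.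
Qed.

Lemma M_inf_al x : x \in M_inf -> al x \in M_inf.
Proof. by move=> /M_infP[n /M_seq_al h]; apply/M_infP; exists n.+1. Qed.

Lemma M_inf_mult u v : al (mu u v) - mu (al u) (al v) \in M_inf.
Proof. by apply/M_infP; exists 0; apply: sub_ideal_gen; exists u, v. Qed.

Section Derivation.
Variable D : A -> A.
Hypotheses (al_lin : linear al) (D_lin : linear D).
Hypothesis D_al : forall u, D (al u) = al (D u).
Hypothesis D_mu : forall u v, D (mu u v) = mu (D u) (al v) + mu (al u) (D v).

Lemma M_seq_D n x : x \in M_seq n -> D x \in M_seq n.+1.
Proof.
have M0 m : 0 \in M_seq m by case: m => [|m]; exact: rpred0.
have MD m u v : u \in M_seq m -> v \in M_seq m -> u + v \in M_seq m.
  by rewrite -{2}[u]scale1r; exact: M_seq_comb.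
suff H m (X : A -> Prop) :
    (forall u, X u -> D u \in M_seq m.+1) ->
    (forall u, u \in ideal_gen mu X -> al u \in M_seq m.+1) ->
    forall u, u \in ideal_gen mu X -> D u \in M_seq m.+1.
  elim: n x => [|n IH] x.
    apply: H => [_ [u [v ->]]|u]; last exact: (@M_seq_al 0).
    apply: (@M_seq_le 0) => //.
    have G u' v' : al (mu u' v') - mu (al u') (al v') \in M_seq 0.
      by apply: sub_ideal_gen; exists u', v'.
    rewrite (linB D_lin) D_al !D_mu (linD al_lin) !D_al opprD addrACA.
    by apply: MD; exact: G.
  apply: H => [u [un|[v vn ->]]|u]; last exact: (@M_seq_al n.+1).
    exact: M_seq_le (IH _ un).
  by rewrite D_al; apply/M_seq_al/IH.
move=> XM aM u uX.
suff [] : u \in ideal_gen mu X /\ D u \in M_seq m.+1 by [].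
move: u uX; apply: ideal_gen_ind.
- by split; [exact: rpred0|rewrite (lin0 D_lin)].
- move=> a v w [vI dv] [wI dw]; split; last by rewrite D_lin; apply: M_seq_comb.
  by apply: rpredD => //; apply: rpredZ.
- move=> a v [vI dv]; have [vI1 vI2] := ideal_gen_two_sided a vI.
  have [l r] := M_seq_two_sided (D a) (aM _ vI).
  have [l' r'] := M_seq_two_sided (al a) dv.
  by split; split; rewrite // D_mu; apply: MD.
- by move=> v Xv; split; [exact: sub_ideal_gen|exact: XM].
Qed.
End Derivation.
End Multiplicative.

Section FreeMult.
Variables (K : fieldType) (V : lmodType K) (alpha : {linear V -> V}).

Definition M_F : {pred FHNAs V} := M_inf (@muF K V) (alphaF alpha).
HB.instance Definition _ := GRing.SubmodClosed.on M_F.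

Definition Fm := quotmod M_F.
HB.instance Definition _ := GRing.Lmodule.on Fm.

Definition pi_M (u : FHNAs V) : Fm := qproj M_F u.
Definition mu_m : Fm -> Fm -> Fm := quot_mul (@muF K V) M_F.
Definition alpha_m : Fm -> Fm := quot_map (alphaF alpha) M_F.
Definition j (v : V) : Fm := pi_M (vec v).

Lemma pi_M_linear : linear pi_M. Proof. exact: linearP. Qed.
Lemma pi_M_surj w : exists u, w = pi_M u.
Proof. by exists (qrepr w); rewrite /pi_M qreprK. Qed.

Lemma mu_mE u v : mu_m (pi_M u) (pi_M v) = pi_M (muF u v).
Proof.
apply: quot_mulE; [exact: muF_linearl|exact: muF_linearr|exact: M_inf_two_sided].
Qed.

Lemma alpha_mE u : alpha_m (pi_M u) = pi_M (alphaF alpha u).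
Proof. by apply: quot_mapE; [exact: alphaF_linear|exact: M_inf_al]. Qed.

Lemma mu_m_linearl w : linear (mu_m^~ w).
Proof.
move=> a u v; case: (pi_M_surj u) (pi_M_surj v) (pi_M_surj w) => u' -> [v' ->] [w' ->].
by rewrite !mu_mE -!pi_M_linear mu_mE muF_linearl.
Qed.

Lemma mu_m_linearr w : linear (mu_m w).
Proof.
move=> a u v; case: (pi_M_surj u) (pi_M_surj v) (pi_M_surj w) => u' -> [v' ->] [w' ->].
by rewrite !mu_mE -!pi_M_linear mu_mE muF_linearr.
Qed.

Lemma alpha_m_linear : linear alpha_m.
Proof.
move=> a u v; case: (pi_M_surj u) (pi_M_surj v) => u' -> [v' ->].
by rewrite !alpha_mE -!pi_M_linear alpha_mE alphaF_linear.
Qed.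

Lemma alpha_m_mul u v : alpha_m (mu_m u v) = mu_m (alpha_m u) (alpha_m v).
Proof.
case: (pi_M_surj u) (pi_M_surj v) => u' -> [v' ->].
by rewrite !(mu_mE, alpha_mE); apply/qproj_eq; exact: M_inf_mult.
Qed.

Lemma alpha_m_j v : alpha_m (j v) = j (alpha v).
Proof. by rewrite alpha_mE alphaF_vec. Qed.

Lemma j_linear : linear j.
Proof.
move=> a u v; rewrite /j -pi_M_linear; congr pi_M; rewrite /vec.
apply: (@tree_pure_multilinear _ _ Leaf 0); split=> [|k]; rewrite ?mxE //.
by rewrite ord1.
Qed.

Lemma Fm_ind (P : Fm -> Prop) :
  (forall v, P (j v)) -> (forall u v, P u -> P v -> P (mu_m u v)) ->
  (forall u, P u -> P (alpha_m u)) -> P 0 ->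
  (forall a u v, P u -> P v -> P (a *: u + v)) -> forall u, P u.
Proof.
move=> Pj Pmu Pal P0 PD w; case: (pi_M_surj w) => u -> {w}.
elim/FHNAs_ind: u => [t x||a x y Px Py]; last by rewrite pi_M_linear; apply: PD.
  elim: t x => [|k l IHl r IHr] x.
    have -> : x = const_mx (x 0 0) by apply/rowP => i; rewrite !mxE ord1.
    exact: Pj.
  elim: k x => [|k IHk] x.
    by rewrite -(hsubmxK x) -(@muF_pure _ _ l r) -mu_mE; apply: Pmu.
  by rewrite -(@alphaF_node _ _ alpha k l r x) -alpha_mE; apply: Pal.
by rewrite (lin0 pi_M_linear).
Qed.

Section Derivation.
Variable d : {linear V -> V}.
Hypothesis d_alpha : forall v, d (alpha v) = alpha (d v).

(* By d_hat_linear, d_hat_j, d_hat_alpha, d_hat_mul and d_hat_unique, this is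
   the unique linear map with d_hat j = j d, d_hat alpha_m = alpha_m d_hat and
   d_hat (u v) = d_hat u * alpha_m v + alpha_m u * d_hat v. *)
Definition d_hat : Fm -> Fm := quot_map (dF alpha d) M_F.

Lemma d_hatE u : d_hat (pi_M u) = pi_M (dF alpha d u).
Proof.
apply: quot_mapE; first exact: dF_linear.
move=> x /M_infP[n xn]; apply/M_infP; exists n.+1.
by apply: M_seq_D xn; [exact: alphaF_linear|exact: dF_linear|exact: dF_alpha|
  exact: dF_mul].
Qed.

Lemma d_hat_linear : linear d_hat.
Proof.
move=> a u v; case: (pi_M_surj u) (pi_M_surj v) => u' -> [v' ->].
by rewrite !d_hatE -!pi_M_linear d_hatE dF_linear.
Qed.

Lemma d_hat_j v : d_hat (j v) = j (d v).
Proof. by rewrite d_hatE dF_vec. Qed.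

Lemma d_hat_alpha u : d_hat (alpha_m u) = alpha_m (d_hat u).
Proof.
case: (pi_M_surj u) => u' ->.
by rewrite !(alpha_mE, d_hatE) dF_alpha.
Qed.

Lemma d_hat_mul u v :
  d_hat (mu_m u v) = mu_m (d_hat u) (alpha_m v) + mu_m (alpha_m u) (d_hat v).
Proof.
case: (pi_M_surj u) (pi_M_surj v) => u' -> [v' ->].
by rewrite !(alpha_mE, d_hatE, mu_mE) dF_mul (linD pi_M_linear).
Qed.

Lemma d_hat_unique (f : Fm -> Fm) : linear f ->
  (forall v, f (j v) = j (d v)) ->
  (forall u, f (alpha_m u) = alpha_m (f u)) ->
  (forall u v, f (mu_m u v) = mu_m (f u) (alpha_m v) + mu_m (alpha_m u) (f v)) ->
  f =1 d_hat.
Proof.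
move=> fl fj fa fm; apply: Fm_ind => [v|u v eu ev|u eu||a u v eu ev].
- by rewrite fj d_hat_j.
- by rewrite fm d_hat_mul eu ev.
- by rewrite fa d_hat_alpha eu.
- by rewrite (lin0 fl) (lin0 d_hat_linear).
- by rewrite fl d_hat_linear eu ev.
Qed.
End Derivation.
End FreeMult.
Arguments pi_M {K V} alpha u.
Arguments mu_m {K V} alpha u v.
Arguments alpha_m {K V} alpha u.
Arguments j {K V} alpha v.
Arguments d_hat {K V} alpha d u.

Section Objects.
Variable K : fieldType.

Record homLieDer := HomLieDer {
  hl_space :> lmodType K;
  hl_br : {bilinear hl_space -> hl_space -> hl_space};
  hl_alpha : {linear hl_space -> hl_space};
  hl_d : {linear hl_space -> hl_space};
  hl_skew : forall x y, hl_br x y = - hl_br y x;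
  hl_jacobi : forall x y z,
    hl_br (hl_alpha x) (hl_br y z) + hl_br (hl_alpha y) (hl_br z x)
      + hl_br (hl_alpha z) (hl_br x y) = 0;
  hl_alpha_br : forall x y,
    hl_alpha (hl_br x y) = hl_br (hl_alpha x) (hl_alpha y);
  hl_d_alpha : forall x, hl_d (hl_alpha x) = hl_alpha (hl_d x);
  hl_d_br : forall x y,
    hl_d (hl_br x y) = hl_br (hl_d x) (hl_alpha y) + hl_br (hl_alpha x) (hl_d y) }.

Variables (A : lmodType K) (mu : A -> A -> A) (alpha D : A -> A).

Record is_homNonassoc : Prop := {
  hn_mu_bilinear : bilinear_for *:%R *:%R mu;
  hn_alpha_linear : linear alpha;
  hn_alpha_mul : forall a b, alpha (mu a b) = mu (alpha a) (alpha b) }.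

Record is_homAssoc : Prop := {
  ha_nonassoc :> is_homNonassoc;
  ha_assoc : forall a b c, mu (alpha a) (mu b c) = mu (mu a b) (alpha c) }.

Record is_alphaDerivation : Prop := {
  ad_linear : linear D;
  ad_alpha : forall a, D (alpha a) = alpha (D a);
  ad_leibniz : forall a b, D (mu a b) = mu (D a) (alpha b) + mu (alpha a) (D b) }.

Definition is_homAsDer : Prop := is_homAssoc /\ is_alphaDerivation.
End Objects.

Section EnvelopingRelations.
Variables (K : fieldType) (g A : lmodType K) (br : g -> g -> g).
Variables (mu : A -> A -> A) (al : A -> A) (i : g -> A).

Definition env_rel (w : A) : Prop :=
  (exists u v z, w = mu (al u) (mu v z) - mu (mu u v) (al z)) \/
  (exists x y, w = i (br x y) - (mu (i x) (i y) - mu (i y) (i x))).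

Variables (D : A -> A) (ag dg : g -> g).
Hypotheses (al_lin : linear al) (al_mu : forall u v, al (mu u v) = mu (al u) (al v)).
Hypotheses (D_lin : linear D) (D_al : forall u, D (al u) = al (D u)).
Hypothesis D_mu : forall u v, D (mu u v) = mu (D u) (al v) + mu (al u) (D v).
Hypotheses (mul : forall v, linear (mu^~ v)) (mur : forall u, linear (mu u)).
Hypothesis i_lin : linear i.
Hypothesis ag_br : forall x y, ag (br x y) = br (ag x) (ag y).
Hypothesis dg_br : forall x y, dg (br x y) = br (dg x) (ag y) + br (ag x) (dg y).
Hypotheses (al_i : forall x, al (i x) = i (ag x)) (D_i : forall x, D (i x) = i (dg x)).

Lemma env_ideal_stable u :
  u \in ideal_gen mu env_rel ->
  al u \in ideal_gen mu env_rel /\ D u \in ideal_gen mu env_rel.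
Proof.
set I := ideal_gen mu env_rel.
have As a b c : mu (al a) (mu b c) - mu (mu a b) (al c) \in I.
  by apply: sub_ideal_gen; left; exists a, b, c.
have Br x y : i (br x y) - (mu (i x) (i y) - mu (i y) (i x)) \in I.
  by apply: sub_ideal_gen; right; exists x, y.
have ID v w : v \in I -> w \in I -> v + w \in I by exact: rpredD.
move=> uI; suff [] : u \in I /\ (al u \in I /\ D u \in I) by [].
move: u uI; apply: ideal_gen_ind.
- by rewrite (lin0 al_lin) (lin0 D_lin); do !split; exact: rpred0.
- move=> a x y [xI [ax dx]] [yI [ay dy]].
  by rewrite al_lin D_lin; do !split; apply: ID => //; apply: rpredZ.
- move=> a x [xI [ax dx]]; rewrite !al_mu !D_mu.
  have T b z : z \in I -> mu b z \in I /\ mu z b \in I.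
    exact: ideal_gen_two_sided.
  have [l r] := T a x xI; have [al' ar'] := T (al a) _ ax.
  have [dl dr] := T (D a) _ ax; have [adl adr] := T (al a) _ dx.
  by do !split; rewrite ?al_mu //; apply: ID.
- have E1 (a b c a' b' c' : A) :
      a + (b + c) - (a' + b' + c') = (a - a') + (b - b') + (c - c').
    by rewrite addrA !opprD addrACA [X in X + _]addrACA.
  have E2 (a b c e c' e' : A) :
      a + b - (c + e - (c' + e')) = (a - (c - e')) + (b - (e - c')).
    by rewrite addrACA -opprD; congr (_ - _); rewrite addrACA -opprD (addrC e').
  move=> _ [[u [v [w ->]]]|[x [y ->]]]; split.
  + exact: As.
  + rewrite (linB al_lin) (linB D_lin) !al_mu !D_mu !al_mu !D_al; split=> //.
    rewrite (linD (mur _)) (linD (mul _)) E1.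
    exact: ID (ID _ _ (As _ _ _) (As _ _ _)) (As _ _ _).
  + exact: Br.
  + rewrite !(linB al_lin) !(linB D_lin) !al_mu !D_mu !al_i !D_i ag_br dg_br.
    by split=> //; rewrite (linD i_lin) E2; apply: ID; exact: Br.
Qed.
End EnvelopingRelations.

Section Enveloping.
Variables (K : fieldType) (g : homLieDer K).

Notation al := (@hl_alpha K g).
Notation dg := (@hl_d K g).
Notation mum := (mu_m al).
Notation alm := (alpha_m al).
Notation dhat := (d_hat al dg).

Definition I_U : {pred Fm al} := ideal_gen mum (env_rel (hl_br g) mum alm (j al)).
HB.instance Definition _ := GRing.SubmodClosed.on I_U.

Definition Um := quotmod I_U.
HB.instance Definition _ := GRing.Lmodule.on Um.

Definition pi_I (u : Fm al) : Um := qproj I_U u.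
Definition mu_U : Um -> Um -> Um := quot_mul mum I_U.
Definition alpha_U : Um -> Um := quot_map alm I_U.
Definition D_U : Um -> Um := quot_map dhat I_U.

Lemma I_U_stable u : u \in I_U -> alm u \in I_U /\ dhat u \in I_U.
Proof.
apply: env_ideal_stable; [exact: alpha_m_linear|exact: alpha_m_mul|
  exact/d_hat_linear/hl_d_alpha|exact/d_hat_alpha/hl_d_alpha|
  exact/d_hat_mul/hl_d_alpha|exact: mu_m_linearl|exact: mu_m_linearr|
  exact: j_linear|exact: hl_alpha_br|exact: hl_d_br|exact: alpha_m_j|
  exact/d_hat_j/hl_d_alpha].
Qed.

Lemma mu_UE u v : mu_U (pi_I u) (pi_I v) = pi_I (mum u v).
Proof.
apply: quot_mulE; [exact: mu_m_linearl|exact: mu_m_linearr|].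
exact: ideal_gen_two_sided.
Qed.

Lemma alpha_UE u : alpha_U (pi_I u) = pi_I (alm u).
Proof. by apply: quot_mapE => [|x /I_U_stable[]//]; exact: alpha_m_linear. Qed.

Lemma D_UE u : D_U (pi_I u) = pi_I (dhat u).
Proof.
apply: quot_mapE => [|x /I_U_stable[]//]; apply: d_hat_linear.
exact: hl_d_alpha.
Qed.
End Enveloping.

(* Main.v *)
Require Import Defs.
From HB Require Import structures.
From mathcomp Require Import all_boot all_algebra.
Set Implicit Arguments.
Unset Strict Implicit.
Unset Printing Implicit Defensive.
Import GRing.Theory.
Local Open Scope ring_scope.

(** The map [pi_I] is linear, surjective and intertwines the operations of [Fm] with those of [Um]
    ([mu_UE], [alpha_UE], [D_UE]), which are well defined because I is a two-sided ideal stable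
    under [alpha_m] and [d_hat]. So every identity valid in [Fm] descends: bilinearity,
    multiplicativity of the twist, and the two laws of an alpha-derivation. Only Hom-associativity
    ([mu_U_homAssoc]) comes from the quotient itself, since I contains all Hom-associators. *)

Section Enveloping.
Variables (K : fieldType) (g : homLieDer K).

Notation al := (@hl_alpha K g).
Notation dg := (@hl_d K g).

Lemma pi_I_linear : linear (@pi_I K g).
Proof. exact: linearP. Qed.

Lemma pi_I_surj (x : Um g) : exists u, x = pi_I u.
Proof. by exists (qrepr x); rewrite /pi_I qreprK. Qed.

(** The lemmas on [d_hat] used below take this as a hypothesis: it is what lets [dF] preserve
    [M_F]. *)
Lemma d_alphaC v : dg (al v) = al (dg v).
Proof. exact: hl_d_alpha. Qed.

Lemma mu_U_bilinear : bilinear_for *:%R *:%R (@mu_U K g).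
Proof.
split=> w a u v; case: (pi_I_surj u) (pi_I_surj v) (pi_I_surj w) => u' -> [v' ->] [w' ->].
  by rewrite -pi_I_linear !mu_UE mu_m_linearl pi_I_linear.
by rewrite -pi_I_linear !mu_UE mu_m_linearr pi_I_linear.
Qed.

Lemma alpha_U_linear : linear (@alpha_U K g).
Proof.
move=> a u v; case: (pi_I_surj u) (pi_I_surj v) => u' -> [v' ->].
by rewrite -pi_I_linear !alpha_UE alpha_m_linear pi_I_linear.
Qed.

Lemma D_U_linear : linear (@D_U K g).
Proof.
move=> a u v; case: (pi_I_surj u) (pi_I_surj v) => u' -> [v' ->].
by rewrite -pi_I_linear !D_UE (d_hat_linear d_alphaC) pi_I_linear.
Qed.

Lemma alpha_U_mul (a b : Um g) :
  alpha_U (mu_U a b) = mu_U (alpha_U a) (alpha_U b).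
Proof.
case: (pi_I_surj a) (pi_I_surj b) => u -> [v ->].
by rewrite mu_UE !alpha_UE mu_UE alpha_m_mul.
Qed.

Lemma mu_U_homAssoc (a b c : Um g) :
  mu_U (alpha_U a) (mu_U b c) = mu_U (mu_U a b) (alpha_U c).
Proof.
case: (pi_I_surj a) (pi_I_surj b) (pi_I_surj c) => u -> [v ->] [w ->].
(* Equality of the two classes means that the Hom-associator of the representatives lies in I; it is
   a generator of the first kind in [env_rel]. *)
rewrite !alpha_UE !mu_UE; apply/qproj_eq/sub_ideal_gen.
by left; exists u, v, w.
Qed.

Lemma D_U_alpha (a : Um g) : D_U (alpha_U a) = alpha_U (D_U a).
Proof.
case: (pi_I_surj a) => u ->.
by rewrite D_UE !alpha_UE D_UE (d_hat_alpha d_alphaC).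
Qed.

Lemma D_U_leibniz (a b : Um g) :
  D_U (mu_U a b) = mu_U (D_U a) (alpha_U b) + mu_U (alpha_U a) (D_U b).
Proof.
case: (pi_I_surj a) (pi_I_surj b) => u -> [v ->].
(* The Leibniz rule in [Fm] yields the class of a sum, which additivity of [pi_I] splits. *)
by rewrite mu_UE !D_UE !alpha_UE !mu_UE (d_hat_mul d_alphaC) (linD pi_I_linear).
Qed.
End Enveloping.

Theorem proposition3p8 (K : fieldType) (charK : [pchar K] =i pred0)
    (g : homLieDer K) :
  is_homAsDer (@mu_U K g) (@alpha_U K g) (@D_U K g).
Proof.
split; last by split; [exact: D_U_linear|exact: D_U_alpha|exact: D_U_leibniz].
split; last exact: mu_U_homAssoc.
by split; [exact: mu_U_bilinear|exact: alpha_U_linear|exact: alpha_U_mul].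
Qed.
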